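(* Let $m\ge 2$, $n\ge 1$ be integers, $\mathcal{A}\in T_{m,n}$ and $q\in\mathbb{R}^n$. Then TCP$(\mathcal{A},q)$ has a solution if and only if TCP$(\mathcal{A},\beta^{m-1}q)$ has a solution for all real numbers $\beta>0$.
   Context: $[n]=\{1,\ldots,n\}$. $T_{m,n}$ is the set of all real $m$th-order $n$-dimensional tensors, i.e. arrays $\mathcal{A}=(a_{i_1\ldots i_m})$ of real numbers with $i_1,\ldots,i_m\in[n]$. For $x\in\mathbb{R}^n$, $\mathcal{A}x^{m-1}\in\mathbb{R}^n$ is the vector with components $(\mathcal{A}x^{m-1})_i=\sum_{i_2,\ldots,i_m=1}^{n}a_{ii_2\ldots i_m}x_{i_2}\cdots x_{i_m}$. Vector inequalities are componentwise. For $p\in\mathbb{R}^n$, the tensor complementarity problem TCP$(\mathcal{A},p)$ is: find $x\in\mathbb{R}^n$ with $x\ge 0$, $\mathcal{A}x^{m-1}+p\ge 0$ and $x^\top(\mathcal{A}x^{m-1}+p)=0$; such an $x$ is called a solution. *)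

(* Defs.v *)
From HB Require Import structures.
From mathcomp Require Import all_boot all_order all_algebra.
From mathcomp Require Import reals.

Set Implicit Arguments.
Unset Strict Implicit.
Unset Printing Implicit Defensive.

Import Order.TTheory GRing.Theory Num.Theory.
Local Open Scope ring_scope.

(* Indices run over 'I_n = {0, ..., n-1} instead of {1, ..., n}. *)
Definition tensor (R : realType) (m n : nat) : Type :=
  {ffun m.-tuple 'I_n -> R}.

(* The vector A x^{m-1}.  Summing over the index tuples (i_1, ..., i_m) whose
   first entry i_1 is i amounts to summing over all (i_2, ..., i_m), and avoids
   a cast between the lengths (m - 1) + 1 and m.  For m = 0 it is the zero
   vector. *)
Definition tensor_vec (R : realType) (m n : nat)
    (A : tensor R m n) (x : 'cV[R]_n) : 'cV[R]_n :=
  \col_(i < n) \sum_(t : m.-tuple 'I_n | ohead t == Some i)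
                 A t * \prod_(j <- behead t) x j 0.

Definition nonneg_vec (R : realType) (n : nat) (x : 'cV[R]_n) : Prop :=
  forall i : 'I_n, 0 <= x i 0.

Definition tcp_solution (R : realType) (m n : nat)
    (A : tensor R m n) (p x : 'cV[R]_n) : Prop :=
  [/\ nonneg_vec x,
      nonneg_vec (tensor_vec A x + p) &
      x^T *m (tensor_vec A x + p) = 0].

Definition tcp_solvable (R : realType) (m n : nat)
    (A : tensor R m n) (p : 'cV[R]_n) : Prop :=
  exists x : 'cV[R]_n, tcp_solution A p x.

(* Main.v *)
Require Import Defs.
From mathcomp Require Import all_boot all_order all_algebra.
From mathcomp Require Import reals.
Import Order.TTheory GRing.Theory Num.Theory.
Local Open Scope ring_scope.

(** The map [x |-> A x^{m-1}] is homogeneous of degree [m - 1].  Hence scaling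
    [x] by a positive [beta] and [q] by [beta^{m-1}] multiplies [A x^{m-1} + q]
    by [beta^{m-1}]: both nonnegativity conditions survive, and the
    complementarity product is multiplied by [beta^m], so it still vanishes
    ([tcp_solution_scale]).  This gives the forward implication; the converse
    is the case [beta = 1]. *)

(** Each monomial of [A x^{m-1}] is a product over the tail of an [m]-tuple,
    which has [m - 1] factors. *)
Lemma tensor_vec_scale (R : realType) (m n : nat) (A : tensor R m n)
    (b : R) (x : 'cV[R]_n) :
  tensor_vec A (b *: x) = b ^+ (m - 1) *: tensor_vec A x.
Proof.
apply/colP => i; rewrite !mxE mulr_sumr; apply: eq_bigr => t _.
under eq_bigr => j _ do rewrite mxE.
rewrite big_split big_const_seq count_predT iter_mulr_1 size_behead size_tuple.
by rewrite subn1 mulrCA.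
Qed.

Lemma nonneg_vec_scale (R : realType) (n : nat) (b : R) (x : 'cV[R]_n) :
  0 <= b -> nonneg_vec x -> nonneg_vec (b *: x).
Proof. by move=> b_ge0 x_ge0 i; rewrite mxE mulr_ge0. Qed.

Lemma tcp_solution_scale (R : realType) (m n : nat) (A : tensor R m n)
    (b : R) (p x : 'cV[R]_n) :
  0 <= b -> tcp_solution A p x ->
  tcp_solution A (b ^+ (m - 1) *: p) (b *: x).
Proof.
move=> b_ge0 [x_ge0 Axp_ge0 compl].
rewrite /tcp_solution tensor_vec_scale -scalerDr; split.
- exact: nonneg_vec_scale.
- by apply: nonneg_vec_scale => //; apply: exprn_ge0.
- by rewrite -scalemxAr [(b *: x)^T]linearZ -scalemxAl compl !scaler0.
Qed.

Theorem lemma1 (R : realType) (m n : nat) (hm : (2 <= m)%N) (hn : (1 <= n)%N)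
    (A : tensor R m n) (q : 'cV[R]_n) :
  tcp_solvable A q <->
  (forall beta : R, 0 < beta -> tcp_solvable A (beta ^+ (m - 1) *: q)).
Proof.
split=> [[x sol_x] beta beta_gt0 | solvable].
  by exists (beta *: x); apply: tcp_solution_scale => //; apply: ltW.
by have := solvable 1 ltr01; rewrite expr1n scale1r.
Qed.
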